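(* Let $n=3s+t$ with integers $s\geq 3$ and $0\leq t\leq 2$, and let $VQ_n$ be the $n$-dimensional varietal hypercube. If $g$ is an integer with $0\leq g\leq n-s$, then $\kappa_g(VQ_n)=f_n(g)$, where $f_n(g)=n(g+1)-\frac{g(g+3)}{2}$.
   Context: All graphs are finite, simple, undirected. The varietal hypercube $VQ_n$ ($n\ge1$) is the graph with vertex set the set of all binary strings $x_nx_{n-1}\ldots x_2x_1$, $x_i\in\mathbb{Z}_2$, defined recursively. $VQ_1$ is the complete graph on the two vertices labeled $0$ and $1$. For $n\geq 2$, let $VQ_n^0$ (resp. $VQ_n^1$) be the graph obtained from $VQ_{n-1}$ by inserting a $0$ (resp. $1$) in front of each vertex label. Then $VQ_n$ is obtained from the disjoint union of $VQ_n^0$ and $VQ_n^1$ by joining vertices according to the rule: $0x_{n-1}x_{n-2}\ldots x_1$ in $VQ_n^0$ and $1y_{n-1}y_{n-2}\ldots y_1$ in $VQ_n^1$ are adjacent if and only if one of the following holds: (1) $3\nmid n$ and $x_{n-1}\ldots x_1=y_{n-1}\ldots y_1$; (2) $3\mid n$, $x_{n-3}\ldots x_1=y_{n-3}\ldots y_1$, and $(x_{n-1}x_{n-2},\,y_{n-1}y_{n-2})\in\{(00,00),(01,01),(10,11),(11,10)\}$. For a connected graph $G$ and an integer $g\ge 0$, a set $S$ of vertices is a cutset if $G-S$ is not connected; a cutset $S$ is an $R_g$-cutset if every connected component of $G-S$ has at least $g+1$ vertices. If $G$ has at least one $R_g$-cutset, the $g$-extra connectivity $\kappa_g(G)$ is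 the minimum cardinality of an $R_g$-cutset of $G$. *)

(* Defs.v *)
From mathcomp Require Import all_boot.
From mathcomp Require Import zify.

Set Implicit Arguments.
Unset Strict Implicit.
Unset Printing Implicit Defensive.

(* The string x_n x_(n-1) ... x_1 is the tuple with head x_n and last item
   x_1, with true for 1 and false for 0. *)

(* The edges between 0x and 1y in VQ_n, for strings x and y of length n - 1.
   This relation is symmetric in x and y. *)
Definition vq_cross (n : nat) (x y : seq bool) : bool :=
  if 3 %| n then
    (drop 2 x == drop 2 y) &&
    ((take 2 x, take 2 y) \in
       [:: ([:: false; false], [:: false; false]);
           ([:: false; true],  [:: false; true]);
           ([:: true; false],  [:: true; true]);
           ([:: true; true],   [:: true; false])])
  else x == y.

(* The value at n = 0 is a dummy: VQ_n is only defined for n >= 1. *)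
Fixpoint vq_adj (n : nat) : rel (n.-tuple bool) :=
  match n return rel (n.-tuple bool) with
  | 0 => fun _ _ => false
  | m.+1 => fun x y =>
      if m == 0 then x != y
      else if thead x == thead y then
        @vq_adj m (behead_tuple x) (behead_tuple y)
      else vq_cross m.+1 (behead x) (behead y)
  end.

Section ExtraConnectivity.

Variables (T : finType) (e : rel T).

Definition del_adj (S : {set T}) : rel T :=
  [rel x y | [&& x \notin S, y \notin S & e x y]].

Definition cutset (S : {set T}) : bool :=
  [exists x in ~: S, exists y in ~: S, ~~ connect (del_adj S) x y].

(* Meaningful for x \notin S only. *)
Definition component (S : {set T}) (x : T) : {set T} :=
  [set y | connect (del_adj S) x y].

Definition Rg_cutset (g : nat) (S : {set T}) : bool :=
  cutset S && [forall x in ~: S, g.+1 <= #|component S x|].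

(* None when there is no R_g-cutset, in which case kappa_g is undefined. *)
Definition extra_connectivity (g : nat) : option nat :=
  if [pick S | Rg_cutset g S] is Some S0
  then Some #|[arg min_(S < S0 | Rg_cutset g S) #|S|]|
  else None.

End ExtraConnectivity.

(* The division is exact, and the subtraction is not truncated for g <= n:
   see f_bound_exact. *)
Definition f_bound (n g : nat) : nat := n * (g + 1) - (g * (g + 3)) %/ 2.

Lemma vq_cross_sym n : symmetric (vq_cross n).
Proof.
move=> x y; rewrite /vq_cross; case: ifP => _; rewrite [_ == _]eq_sym //.
by congr (_ && _); rewrite !inE !xpair_eqE;
  case: (take 2 x) => [|[] [|[] [|? ?]]]; case: (take 2 y) => [|[] [|[] [|? ?]]].
Qed.

Lemma vq_adj_sym n : symmetric (@vq_adj n).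
Proof.
elim: n => [|m IHm] x y //=; rewrite [x == y]eq_sym [thead y == _]eq_sym.
by rewrite vq_cross_sym; case: (m == 0) => //; case: eqP => // _; apply: IHm.
Qed.

Lemma vq_adj_irrefl n : irreflexive (@vq_adj n).
Proof.
by elim: n => [|m IHm] x //=; rewrite !eqxx; case: (m == 0) => //; apply: IHm.
Qed.

Lemma extra_connectivityP (T : finType) (e : rel T) (g k : nat) :
  extra_connectivity e g = Some k <->
  (exists2 S, Rg_cutset e g S & #|S| = k) /\
  (forall S, Rg_cutset e g S -> k <= #|S|).
Proof.
rewrite /extra_connectivity; case: pickP => [S0 S0P | noS]; last first.
  by split=> // -[[S SP]]; rewrite noS in SP.
case: arg_minnP => // S SP Smin; split=> [[<-] | [[S' S'P <-] min']].
  by split=> //; exists S.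
by congr Some; apply/eqP; rewrite eqn_leq Smin // min'.
Qed.

Lemma f_bound_exact n g :
  g <= n -> 2 * f_bound n g + g * (g + 3) = 2 * (n * (g + 1)).
Proof.
move=> le_gn; rewrite /f_bound.
have dv : 2 %| g * (g + 3) by rewrite dvdn2 oddM oddD; case: (odd g).
have : 2 * (g * (g + 3) %/ 2) = g * (g + 3) by rewrite mulnC divnK.
set q := _ %/ 2; nia.
Qed.

(* Main.v *)
Require Import Defs.
From mathcomp Require Import all_boot zify.

(** Deleting the last-added coordinate splits the varietal hypercube into two
copies of the smaller one, joined by a perfect matching: 0x is matched to 1y
where y is the mate of x, and taking mates is an involution.  The lower bound
uses only this recursive structure, whatever the involutions are.

Write F(n, k) = n k - (k^2 + k - 2) / 2, so that F(n, g + 1) = f_n(g).  An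
R_g-cutset S splits the remaining vertices into two parts X and Y with no edge
between them, each with at least g + 1 vertices.  Hence the lower bound follows
from [separated_bound]: if two separated sets have at least k vertices, where
1 <= k <= n - 2, then at least F(n, k) vertices lie outside both.  The proof is
by induction on n.  Let a0, a1, b0, b1 be the sizes of X and Y in the two halves.
Each half inherits a separated pair, and the matching forbids X to face Y, so
that a0 + b1 and a1 + b0 are at most 2^(n-1).  If the same set is the smaller
one in both halves, then F(n-1, p) + F(n-1, q) >= F(n, p + q) for p, q >= 1
suffices when this set meets both halves; when it lies in one half, the mates of
its members all lie in the cut, and F(n-1, k) + k = F(n, k).  If X is smaller in one half and Y in the other, then
either both small parts are tiny and the matching makes the cut exponentially
large, or one of them has at least n - 3 vertices and its half alone pays almost
everything.  The range of k shrinks with n; the single size that falls out of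
the induction, k = n - 2 with the set inside one half, is covered by
[bdry_expansion]: every nonempty set of k vertices has at least F(n, k) outer
neighbours, for all k, by the same superadditivity.

For the upper bound, the cutset is the boundary of a star with g leaves centred
at the origin.  Stars are grown along the coordinates ([star_exists]): a new
coordinate whose index is not a multiple of 3 may contribute a leaf, because
there the mate of x is x itself and each new leaf shares a neighbour with each
old one.  This gives n - s leaves at most, and a boundary of size at most
f_n(g).  It remains that the components off the star are large.  A
vertex outside the star and its boundary has at most 4 neighbours in the
boundary, and the graph has no triangle, so that each such component has at
least 2 (n - 4) >= g + 1 vertices, since n >= 9 and g <= n - 3. *)

Set Implicit Arguments.
Unset Strict Implicit.
Unset Printing Implicit Defensive.

(** * Neighbourhoods, boundaries and cutsets *)

Section Boundary.

Variables (T : finType) (e : rel T).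

Definition nbhd (x : T) : {set T} := [set y | e x y].

Definition bdry (X : {set T}) : {set T} := [set y in ~: X | [exists x in X, e x y]].

Lemma bdryP (X : {set T}) y :
  reflect (y \notin X /\ exists2 x, x \in X & e x y) (y \in bdry X).
Proof.
rewrite !inE; apply: (iffP andP) => -[yX].
  by case/exists_inP=> x xX exy; split=> //; exists x.
by case=> x xX exy; split=> //; apply/exists_inP; exists x.
Qed.

Lemma bdry1 x : irreflexive e -> bdry [set x] = nbhd x.
Proof.
move=> irr; apply/setP=> y; rewrite [RHS]inE; apply/bdryP/idP.
  by case=> _ [z /set1P->].
move=> exy; split; last by exists x; rewrite ?set11.
by apply/set1P=> yx; rewrite yx irr in exy.
Qed.

Lemma bdry0 : bdry set0 = set0.
Proof. by apply/setP=> y; rewrite in_set0; apply/bdryP=> -[_ [x]]; rewrite in_set0. Qed.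

End Boundary.

Section Cutsets.

Variables (T : finType) (e : rel T).
Hypothesis e_sym : symmetric e.

Lemma del_adj_sym S : symmetric (del_adj e S).
Proof. by move=> x y; rewrite /del_adj /= [e x y]e_sym andbCA. Qed.

Lemma component_sub (S A : {set T}) x : x \in A ->
  (forall y z, y \in A -> z \notin S -> e y z -> z \in A) -> component e S x \subset A.
Proof.
move=> xA clA; apply/subsetP=> y; rewrite inE => /connectP[p pth ->].
elim: p x xA pth => //= z p IHp x xA /andP[/and3P[_ zS xz]].
by apply: IHp; apply: clA xz.
Qed.

(** One part is a component of the graph without S, the other is everything else:
it contains another component, hence it is large too. *)
Lemma Rg_cutset_parts g S : Rg_cutset e g S ->
  exists X Y : {set T},
    [/\ g < #|X|, g < #|Y|, #|S| + (#|X| + #|Y|) = #|T|, [disjoint X & Y] &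
        {in X & Y, forall x y, ~~ e x y}].
Proof.
case/andP=> /exists_inP[x xS /exists_inP[y yS xyN]] /forall_inP cmp.
pose X := component e S x; pose Y := ~: S :\: X.
have XS : X \subset ~: S.
  by apply: component_sub => // u v _ vS _; rewrite inE.
have YX : component e S y \subset Y.
  apply: component_sub => [|u v]; rewrite !inE; first by rewrite inE in yS; rewrite xyN yS.
  case/andP=> xuN uS vS uv; apply/andP; split=> //; apply: contra xuN => xv.
  by apply: connect_trans xv (connect1 _); apply/and3P; rewrite e_sym.
exists X, Y; split.
- exact: cmp.
- exact: leq_trans (cmp _ yS) (subset_leq_card YX).
- by rewrite -{1}(setIidPr XS) cardsID cardsC.
- by rewrite disjoint_sym disjoints_subset subsetDr.
move=> u v uX; have := subsetP XS u uX; rewrite !inE => uS /andP[xvN vS].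
rewrite inE in uX; apply: contra xvN => uv.
by apply: connect_trans uX (connect1 _); apply/and3P.
Qed.

(** A set X inside the closed neighbourhood of one of its members o is connected,
so it is a component once its boundary is deleted.  The vertex y
shows that something is left on the other side. *)
Lemma bdry_Rg_cutset g (X : {set T}) o y :
  o \in X -> X \subset o |: nbhd e o -> g < #|X| ->
  y \notin X :|: bdry e X ->
  (forall z, z \notin X :|: bdry e X -> g < #|component e (bdry e X) z|) ->
  Rg_cutset e g (bdry e X).
Proof.
move=> oX Xo gX; rewrite in_setU negb_or => /andP[yX yS] big.
have notS x : x \in X -> x \notin bdry e X by move=> xX; apply/bdryP; rewrite xX => -[].
have oS := notS o oX.
apply/andP; split.
  apply/exists_inP; exists o; first by rewrite inE.
  apply/exists_inP; exists y; first by rewrite inE.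
  have : component e (bdry e X) o \subset X.
    apply: component_sub => // u v uX vS uv; apply: contraR vS => vX.
    by apply/bdryP; split=> //; exists u.
  by move/subsetP/(_ y); rewrite inE (negPf yX); case: connect => // /(_ isT).
apply/forall_inP=> x; rewrite inE => xS.
have [xX | xX] := boolP (x \in X); last by apply: big; rewrite in_setU negb_or xX.
have o_conn z : z \in X -> connect (del_adj e (bdry e X)) o z.
  move=> zX; have /subsetP/(_ _ zX) := Xo; rewrite !inE => /predU1P[-> // | oz].
  by apply: connect1; apply/and3P; split; rewrite ?notS.
apply: leq_trans gX (subset_leq_card _); apply/subsetP=> z zX; rewrite inE.
apply: connect_trans (o_conn z zX).
by rewrite (sym_connect_sym (@del_adj_sym _)) o_conn.
Qed.

(** In the absence of triangles, two adjacent vertices of the component have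
disjoint neighbourhoods, and both stay in the component once S is removed. *)
Lemma component_ge (S : {set T}) d y :
  (forall u v w, e u v -> e v w -> e u w = false) -> y \notin S -> 0 < d ->
  (forall z, z \in component e S y -> d <= #|nbhd e z :\: S|) ->
  2 * d <= #|component e S y|.
Proof.
move=> tri yS d_gt0 deg.
have outS z : z \in component e S y -> z \notin S.
  suff sub : component e S y \subset ~: S by move/(subsetP sub); rewrite inE.
  by apply: component_sub => [|u v _ vS _]; rewrite inE.
have nbC z : z \in component e S y -> nbhd e z :\: S \subset component e S y.
  move=> zC; have zS := outS z zC; rewrite inE in zC.
  apply/subsetP=> u; rewrite !inE => /andP[uS zu].
  by apply: connect_trans zC (connect1 _); apply/and3P.
have yC : y \in component e S y by rewrite inE.
have /card_gt0P[z zN] := leq_trans d_gt0 (deg y yC).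
have zC := subsetP (nbC y yC) z zN.
rewrite mul2n -addnn (leq_trans (leq_add (deg y yC) (deg z zC))) //.
rewrite -cardsUI [X in _ + X](_ : _ = 0) ?addn0.
  by rewrite subset_leq_card // subUset !nbC.
apply/eqP; rewrite cards_eq0; apply/set0Pn=> -[u]; rewrite !inE in zN *.
by case/andP=> /andP[_ yu] /andP[_ zu]; case/andP: zN => _ /tri/(_ zu); rewrite yu.
Qed.

End Cutsets.

Lemma eq_Rg_cutset (T : finType) (e e' : rel T) g S :
  e =2 e' -> Rg_cutset e g S = Rg_cutset e' g S.
Proof.
move=> ee'; have cc : connect (del_adj e S) =2 connect (del_adj e' S).
  by apply: eq_connect => x y; rewrite /del_adj /= ee'.
rewrite /Rg_cutset /cutset; congr andb.
  by apply: eq_existsb => x; congr andb; apply: eq_existsb => y; rewrite cc.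
apply: eq_forallb => x; congr (_ ==> (_ < _)).
by apply: eq_card => y; rewrite !inE cc.
Qed.

(** * The two halves of a set of strings *)

Section Halves.

Variable n : nat.
Implicit Types X Y : {set n.+1.-tuple bool}.

Definition half (b : bool) (X : {set n.+1.-tuple bool}) : {set n.-tuple bool} :=
  [set x : n.-tuple bool | [tuple of b :: x] \in X].

Lemma in_half b y X : (y \in half b X) = ([tuple of b :: y] \in X).
Proof. by rewrite inE. Qed.

Lemma half_card X : #|X| = #|half false X| + #|half true X|.
Proof.
have inj b : injective (fun x : n.-tuple bool => [tuple of b :: x]).
  by move=> x y /(congr1 val) [] /val_inj.
rewrite -(card_imset _ (inj false)) -(card_imset _ (inj true)).
rewrite -cardsUI [X in _ = _ + X](_ : _ = 0) ?addn0; last first.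
  apply/eqP; rewrite cards_eq0; apply/set0Pn=> -[z /setIP[]].
  by case/imsetP=> x _ -> /imsetP[y _] /(congr1 val).
congr #|pred_of_set _|; apply/setP=> z; case/tupleP: z => b x.
rewrite inE; apply/idP/orP.
  by case: b => bxX; [right | left]; apply/imsetP; exists x; rewrite ?inE.
by case=> /imsetP[y]; rewrite inE => yX ->.
Qed.

Lemma half_cardb b X : #|X| = #|half b X| + #|half (~~ b) X|.
Proof. by case: b; rewrite half_card //= addnC. Qed.

Lemma half_subset X Y :
  (forall b, half b X \subset half b Y) -> X \subset Y.
Proof.
move=> XY; apply/subsetP=> z; case/tupleP: z => b x bxX.
by have /subsetP/(_ x) := XY b; rewrite !inE; apply.
Qed.

Lemma halfI b X Y : half b (X :&: Y) = half b X :&: half b Y.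
Proof. by apply/setP=> x; rewrite !inE. Qed.

Lemma behead_cons b (x : n.-tuple bool) : behead_tuple [tuple of b :: x] = x.
Proof. exact: val_inj. Qed.

Lemma cons_tuple_eq b c (x y : n.-tuple bool) :
  ([tuple of b :: x] == [tuple of c :: y]) = (b == c) && (x == y).
Proof. exact: eqseq_cons. Qed.

Definition join_halves (A B : {set n.-tuple bool}) : {set n.+1.-tuple bool} :=
  [set z | behead_tuple z \in if thead z then B else A].

Lemma in_join_halves b (y : n.-tuple bool) (A B : {set n.-tuple bool}) :
  ([tuple of b :: y] \in join_halves A B) = (y \in if b then B else A).
Proof. by rewrite inE theadE behead_cons. Qed.

Lemma half_join b (A B : {set n.-tuple bool}) :
  half b (join_halves A B) = if b then B else A.
Proof. by apply/setP=> x; rewrite in_half in_join_halves. Qed.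

End Halves.

Lemma card_tuple_set n (X : {set n.-tuple bool}) : #|X| <= 2 ^ n.
Proof. by rewrite -card_bool -card_tuple max_card. Qed.

Lemma card_set1I (T : finType) (x : T) (A : {set T}) : #|[set x] :&: A| = (x \in A).
Proof.
case: (boolP (x \in A)) => xA; first by rewrite (setIidPl _) ?cards1 ?sub1set.
by apply/eqP; rewrite cards_eq0; apply/eqP/disjoint_setI0; rewrite disjoints1.
Qed.

(** * Two copies joined by a matching, recursively *)

Section MatchedHalves.

Variable mate : forall n, n.-tuple bool -> n.-tuple bool.
Hypothesis mateK : forall n, involutive (@mate n).

(** Since mates are mutual, the crossing edges 0x - 1y and 1x - 0y are given by the
same condition y = mate x. *)
Fixpoint mh_adj (n : nat) : rel (n.-tuple bool) :=
  match n return rel (n.-tuple bool) with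
  | 0 => fun _ _ => false
  | m.+1 => fun x y =>
      if thead x == thead y then @mh_adj m (behead_tuple x) (behead_tuple y)
      else behead_tuple y == mate (behead_tuple x)
  end.

Lemma mh_adj_cons n b c (x y : n.-tuple bool) :
  mh_adj [tuple of b :: x] [tuple of c :: y] =
  if b == c then mh_adj x y else y == mate x.
Proof. by rewrite /= !theadE !behead_cons. Qed.

Lemma mate_eq n (x y : n.-tuple bool) : (y == mate x) = (x == mate y).
Proof. by rewrite eq_sym (can2_eq (@mateK n) (@mateK n)). Qed.

Lemma mh_adj_sym n : symmetric (@mh_adj n).
Proof.
elim: n => // n IHn x y; case/tupleP: x => b x; case/tupleP: y => c y.
by rewrite !mh_adj_cons [c == b]eq_sym mate_eq IHn.
Qed.

Lemma mh_adj_irr n : irreflexive (@mh_adj n).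
Proof.
by elim: n => // n IHn x; case/tupleP: x => b x; rewrite mh_adj_cons eqxx.
Qed.

Notation nb := (nbhd (@mh_adj _)).
Notation bd := (bdry (@mh_adj _)).

Lemma half_nbhd n b (x : n.-tuple bool) : half b (nb [tuple of b :: x]) = nb x.
Proof. by apply/setP=> y; rewrite !inE mh_adj_cons eqxx. Qed.

Lemma half_nbhdC n b (x : n.-tuple bool) :
  half (~~ b) (nb [tuple of b :: x]) = [set mate x].
Proof. by apply/setP=> y; rewrite !inE mh_adj_cons; case: b. Qed.

(** This is how every induction below descends: an outer neighbour of X in a half
is seen either from the trace of X on this half or through the matching. *)
Lemma in_half_bdry n b (X : {set n.+1.-tuple bool}) y :
  (y \in half b (bd X)) =
  (y \notin half b X) && ((y \in bd (half b X)) || (mate y \in half (~~ b) X)).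
Proof.
rewrite in_half; apply/bdryP/andP; rewrite -in_half => -[yX H]; split=> //.
  case: H => z; case/tupleP: z => c x; rewrite -in_half mh_adj_cons => xX.
  case: eqP xX => [-> | /eqP cb] xX xy; apply/orP.
    by left; apply/bdryP; split=> //; exists x.
  by right; rewrite (eqP xy) mateK; case: c b cb xX {yX xy} => -[].
case/orP: H => [/bdryP[_ [x xX xy]] | myX].
  by exists [tuple of b :: x]; rewrite -?in_half // mh_adj_cons eqxx.
exists [tuple of ~~ b :: mate y]; rewrite -?in_half // mh_adj_cons mateK eqxx.
by case: (b).
Qed.

Lemma card_nbhd n (x : n.-tuple bool) : #|nb x| = n.
Proof.
elim: n x => [|n IHn] x.
  by apply/eqP; rewrite cards_eq0; apply/set0Pn=> -[y]; rewrite inE.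
case/tupleP: x => b x.
by rewrite (half_cardb b) half_nbhd half_nbhdC cards1 IHn addn1.
Qed.

Lemma mate_inj n : injective (@mate n).
Proof. exact: can_inj (@mateK n). Qed.

(** Two of three vertices lie in the same half, and a third one outside it has only
one neighbour there. *)
Lemma mh_adj_triangle n (x y z : n.-tuple bool) :
  mh_adj x y -> mh_adj y z -> mh_adj x z = false.
Proof.
elim: n x y z => // n IHn x y z; case/tupleP: x => b x; case/tupleP: y => c y.
case/tupleP: z => d z; rewrite !mh_adj_cons.
have distinct u v : mh_adj u v -> (u == v :> n.-tuple bool) = false.
  by move=> uv; apply/eqP=> uv1; rewrite uv1 mh_adj_irr in uv.
have [<-|bc] := eqVneq b c; have [bd|bd] := eqVneq b d.
- exact: IHn.
- by move=> /distinct xy /eqP->; rewrite (inj_eq (@mate_inj n)) eq_sym.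
- by rewrite -bd [c == b]eq_sym (negPf bc) => /eqP-> /eqP->; rewrite mateK mh_adj_irr.
have -> : c = d by case: b c d bc bd => -[] [].
by rewrite eqxx => /eqP-> /distinct; rewrite eq_sym.
Qed.

(** Vertices of the same half have no common neighbour in the other half, and
vertices of different halves have at most one in each. *)
Lemma card_common_nbhd n (x y : n.-tuple bool) : x != y -> #|nb x :&: nb y| <= 2.
Proof.
elim: n x y => [|n IHn] x y; first by rewrite [x]tuple0 [y]tuple0.
case/tupleP: x => b x; case/tupleP: y => c y xy.
rewrite (half_cardb b) !halfI half_nbhd half_nbhdC.
have [bc | bc] := eqVneq b c.
  rewrite -bc half_nbhd half_nbhdC.
  have xy' : x != y by apply: contraNneq xy => ->; rewrite bc.
  rewrite [_ :&: [set mate y]](_ : _ = set0) ?cards0 ?addn0; first exact: IHn.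
  apply/setP=> z; rewrite !inE; apply/negP=> /andP[/eqP->].
  by rewrite (inj_eq (@mate_inj n)) (negPf xy').
have -> : b = ~~ c by case: b c bc {xy} => -[].
rewrite half_nbhdC negbK half_nbhd -[2]/(1 + 1) leq_add //.
  by rewrite -[X in _ <= X](cards1 (mate y)) subset_leq_card ?subsetIr.
by rewrite -[X in _ <= X](cards1 (mate x)) subset_leq_card ?subsetIl.
Qed.

Lemma card_nbhd_ball n (x y : n.-tuple bool) :
  x != y -> #|nb x :&: (y |: nb y)| <= 2.
Proof.
move=> xy; rewrite setIUr; have [xy_adj | xyN] := boolP (mh_adj x y).
  rewrite [nb x :&: nb y](_ : _ = set0); last first.
    apply/setP=> z; rewrite !inE; apply/negP=> /andP[xz yz].
    by rewrite (mh_adj_triangle xy_adj yz) in xz.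
  rewrite setU0 (@leq_trans 1) // -[X in _ <= X](cards1 y) subset_leq_card //.
  exact: subsetIr.
rewrite [nb x :&: [set y]](_ : _ = set0) ?set0U ?card_common_nbhd //.
by apply/setP=> z; rewrite !inE; apply/negP=> /andP[xz /eqP zy]; rewrite -zy xz in xyN.
Qed.

(** * Expansion of vertex sets *)

(** The induction step of [bdry_expansion]: here a_i is the size of the set in half
i and s_i the size of its boundary there.  With F(n, k) as at the top, the step
from two nonempty traces uses F(n, p) + F(n, q) - F(n+1, p + q) = (p - 1)(q - 1). *)
Lemma expansion_arith n a0 a1 s0 s1 : 0 < a0 + a1 ->
  (a0 = 0 -> a1 <= s0) -> (a1 = 0 -> a0 <= s1) ->
  (0 < a0 -> 2 * n * a0 + 2 <= 2 * s0 + a0 * (a0 + 1)) ->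
  (0 < a1 -> 2 * n * a1 + 2 <= 2 * s1 + a1 * (a1 + 1)) ->
  2 * n.+1 * (a0 + a1) + 2 <= 2 * (s0 + s1) + (a0 + a1) * (a0 + a1 + 1).
Proof.
case: a0 => [|p]; case: a1 => [|q] // _.
- by move=> /(_ erefl) ? _ _ /(_ isT) ?; lia.
- by move=> _ /(_ erefl) ? /(_ isT) ? _; lia.
move=> _ _ /(_ isT) ? /(_ isT) ?.
nia.
Qed.

(** A set that meets both halves expands in each of them; a set inside one half
expands there and has the mates of all its members as further outer neighbours.
The bound is |bd X| >= n k - (k^2 + k - 2) / 2 with k = |X|, doubled to avoid a
quotient. *)
Lemma bdry_expansion n (X : {set n.-tuple bool}) :
  X != set0 -> 2 * n * #|X| + 2 <= 2 * #|bd X| + #|X| * (#|X| + 1).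
Proof.
elim: n X => [|n IHn] X; first by rewrite -card_gt0; nia.
rewrite -card_gt0 (half_card (bd X)) (half_card X) => X_gt0.
have bd_mate b : #|half b X| = 0 -> #|half (~~ b) X| <= #|half b (bd X)|.
  move/cards0_eq=> Xb0; rewrite -(card_imset _ (@mate_inj n)).
  apply/subset_leq_card/subsetP=> y /imsetP[x xX ->].
  by rewrite in_half_bdry Xb0 mateK xX inE orbT.
have bd_half b : 0 < #|half b X| ->
    2 * n * #|half b X| + 2 <= 2 * #|half b (bd X)| + #|half b X| * (#|half b X| + 1).
  rewrite card_gt0 => /IHn/leq_trans; apply; rewrite leq_add2r leq_mul2l /=.
  apply/subset_leq_card/subsetP=> y yX; rewrite in_half_bdry yX andbT.
  by case/bdryP: yX.
exact: expansion_arith X_gt0 (bd_mate _) (bd_mate _) (bd_half _) (bd_half _).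
Qed.

(** * Sets separated by a cut *)

(** For two separated sets of sizes a and b in a graph with N vertices, this is twice
the inequality N - a - b >= n k - (k^2 + k - 2) / 2. *)
Definition sep_bound (n N k a b : nat) : Prop :=
  2 * n * k + 2 + 2 * (a + b) <= 2 * N + k * (k + 1).

(** What is known, in one half, of the sizes of two separated sets: disjointness, the
expansion of each set, and the induction hypothesis, which stops at p = m - 2. *)
Definition sep_half (m N a b : nat) : Prop :=
  [/\ a + b <= N, 0 < a -> sep_bound m N a a b, 0 < b -> sep_bound m N b a b &
      forall p, 0 < p -> p + 2 <= m -> p <= a -> p <= b -> sep_bound m N p a b].

Lemma sep_boundC n N k a b : sep_bound n N k a b -> sep_bound n N k b a.
Proof. by rewrite /sep_bound addnC [b + a]addnC addnC. Qed.

Lemma sep_halfC m N a b : sep_half m N a b -> sep_half m N b a.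
Proof.
case=> ab sa sb IH; split; first by rewrite addnC.
- by move=> /sb/sep_boundC.
- by move=> /sa/sep_boundC.
- by move=> p p0 pm pb pa; apply/sep_boundC/IH.
Qed.

(** The smaller set lies entirely in one half.  If k = m - 1, the induction hypothesis
is only available at k - 1 and misses the bound by 1; this is regained from the
mates when a > k, and from the expansion of the set when a = k. *)
Lemma sep_bound_one_side m N k a b0 b1 : 1 < k < m ->
  sep_half m N a b0 -> k <= a <= b0 -> a + b1 <= N ->
  sep_bound m.+1 (2 * N) k a (b0 + b1).
Proof.
move=> /andP[k1 km] [ab0 small _ IH] /andP[ka ab] ab1; rewrite /sep_bound.
have [k_small | k_big] := leqP (k + 2) m.
  have := IH _ (ltnW k1) k_small ka (leq_trans ka ab); rewrite /sep_bound; nia.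
have mk : m = k.+1 by lia.
have [a_big | a_small] := ltnP k a.
  have := IH k.-1; rewrite /sep_bound; subst m => /(_ ltac:(lia) ltac:(lia) ltac:(lia) ltac:(lia)).
  have [j jE] : exists j, k = j.+1 by exists k.-1; lia.
  by subst k; rewrite /=; nia.
have ak : a = k by lia.
by subst a m; have := small (ltnW k1); rewrite /sep_bound; nia.
Qed.

(** When the smaller set meets both halves, the two induction hypotheses add up, by
the superadditivity used in [expansion_arith]. *)
Lemma sep_bound_same_side m N k a0 a1 b0 b1 : 1 < k < m ->
  sep_half m N a0 b0 -> sep_half m N a1 b1 -> a0 + b1 <= N -> a1 + b0 <= N ->
  a0 <= b0 -> a1 <= b1 -> k <= a0 + a1 ->
  sep_bound m.+1 (2 * N) k (a0 + a1) (b0 + b1).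
Proof.
move=> km h0 h1 ab01 ab10 ab0 ab1 ka.
case: (posnP a0) => [a00 | a0_gt0].
  by rewrite a00 add0n [b0 + b1]addnC; apply: sep_bound_one_side => //; lia.
case: (posnP a1) => [a10 | a1_gt0].
  by rewrite a10 addn0; apply: sep_bound_one_side => //; lia.
have [p [q [p_gt0 q_gt0 kE pa qa]]] :
    exists p q, [/\ 0 < p, 0 < q, k = p + q, p <= a0 & q <= a1].
  (* k >= 2 is split into two positive parts, thus both at most m - 2. *)
  by exists (minn a0 k.-1), (k - minn a0 k.-1); split; lia.
case: h0 => _ _ _ /(_ p) IH0; case: h1 => _ _ _ /(_ q) IH1.
have := IH0 ltac:(lia) ltac:(lia) ltac:(lia) ltac:(lia).
have := IH1 ltac:(lia) ltac:(lia) ltac:(lia) ltac:(lia).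
rewrite /sep_bound; subst k => H0 H1.
(* (p - 1) (q - 1) >= 0 *)
have : p + q <= p * q + 1 by nia.
nia.
Qed.

(** The bound for n = m + 1 and any k <= n - 2 is at most n (n - 1) / 2, its value at
k = n - 2; the cases where the cut is large need no other information on k. *)
Lemma sep_bound_cap m k : k < m -> 2 * m.+1 * k + 2 <= m * m.+1 + k * (k + 1).
Proof. by move=> km; nia. Qed.

(** The room that 2^m leaves, in [sep_bound_big] and in [sep_bound_cross]
respectively; the first inequality is an equality at m = 3. *)
Lemma expn2_ge m : 2 < m ->
   m * (m + 3) <= 2 * 2 ^ m + 2 /\ m * (m + 5) <= 2 * 2 ^ m + 12.
Proof.
elim: m => // m IHm; rewrite ltnS leq_eqVlt => /predU1P[<- // |]; move: IHm.
by rewrite [2 ^ m.+1]expnS; move: (2 ^ m) => P IH m_gt2; have [] := IH m_gt2; split; nia.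
Qed.

(** X is the smaller set in one half, Y in the other, and X has at least m - 2
vertices where it is smaller.  This half pays (m - 1) m / 2, and the other one
has to pay m more: it does if it contains a vertex of Y, by the induction
hypothesis at 1, and if Y has m vertices facing it.  In the remaining case Y lies
in the half where X is smaller, and both sets are small there. *)
Lemma sep_bound_big m k a0 a1 b0 b1 (N := 2 ^ m) : 1 < k < m ->
  sep_half m N a0 b0 -> sep_half m N a1 b1 -> a0 + b1 <= N -> a1 + b0 <= N ->
  a0 <= b0 -> b1 <= a1 -> k <= b0 + b1 -> m <= a0 + 2 ->
  sep_bound m.+1 (2 * N) k (a0 + a1) (b0 + b1).
Proof.
move=> /andP[k1 km] [ab0 _ _ IH0] [ab1 _ _ IH1] ab01 ab10 ab0' ba1 kb a0_big.
have [N1 N2] := @expn2_ge m ltac:(lia).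
rewrite -/N in N1 N2; clearbody N.
have cap := sep_bound_cap km.
rewrite /sep_bound in IH0 IH1 *.
have := IH0 (m - 2) ltac:(lia) ltac:(lia) ltac:(lia) ltac:(lia).
have -> : m - 2 + 1 = m - 1 by lia.
have [r rE] : exists r, m = r + 3 by exists (m - 3); lia.
have -> : m - 2 = r + 1 by lia.
have -> : m - 1 = r + 2 by lia.
case: (posnP b1) => [b10 | b1_gt0]; last first.
  have := IH1 1 isT ltac:(lia) ltac:(lia) ltac:(lia).
  nia.
have [b0_big | b0_small] := leqP m b0; first by nia.
lia.
Qed.

(** When both small parts have fewer than m - 2 vertices, a1 + b0 <= 2^m already
leaves at least 2^m - 2 (m - 3) vertices outside the two sets. *)
Lemma sep_bound_cross m k a0 a1 b0 b1 (N := 2 ^ m) : 1 < k < m ->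
  sep_half m N a0 b0 -> sep_half m N a1 b1 -> a0 + b1 <= N -> a1 + b0 <= N ->
  a0 <= b0 -> b1 <= a1 -> k <= a0 + a1 -> k <= b0 + b1 ->
  sep_bound m.+1 (2 * N) k (a0 + a1) (b0 + b1).
Proof.
move=> km h0 h1 ab01 ab10 ab0 ba1 ka kb.
have [a0_small | a0_big] := ltnP (a0 + 2) m; last exact: sep_bound_big.
have [b1_small | b1_big] := ltnP (b1 + 2) m; last first.
  rewrite addnC [b0 + b1]addnC; apply/sep_boundC.
  by apply: sep_bound_big; rewrite // 1?addnC //; apply: sep_halfC.
have [_ N2] := @expn2_ge m ltac:(lia).
have := sep_bound_cap (proj2 (andP km)).
by rewrite /sep_bound; case: h0 h1 => ? _ _ _ [? _ _ _]; rewrite /N in ab01 ab10 *; nia.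
Qed.

Lemma sep_bound_step m k a0 a1 b0 b1 (N := 2 ^ m) : 1 < k < m ->
  sep_half m N a0 b0 -> sep_half m N a1 b1 -> a0 + b1 <= N -> a1 + b0 <= N ->
  k <= a0 + a1 -> k <= b0 + b1 ->
  sep_bound m.+1 (2 * N) k (a0 + a1) (b0 + b1).
Proof.
move=> km h0 h1 ab01 ab10 ka kb.
have [/sep_halfC h0' /sep_halfC h1'] := (h0, h1).
case/orP: (leq_total a0 b0) => ab0; case/orP: (leq_total a1 b1) => ab1.
- exact: sep_bound_same_side.
- exact: sep_bound_cross.
- by apply/sep_boundC/sep_bound_cross; rewrite // addnC.
- by apply/sep_boundC/sep_bound_same_side; rewrite // addnC.
Qed.

Lemma connectivity_arith n N a0 a1 b0 b1 : n < N -> (n = 0 -> N = 1) ->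
  0 < a0 + a1 -> 0 < b0 + b1 ->
  (0 < a0 -> 0 < b0 -> n + (a0 + b0) <= N) ->
  (0 < a1 -> 0 < b1 -> n + (a1 + b1) <= N) ->
  a0 + b0 <= N -> a1 + b1 <= N -> a0 + b1 <= N -> a1 + b0 <= N ->
  n.+1 + (a0 + a1 + (b0 + b1)) <= 2 * N.
Proof. lia. Qed.

Definition separated n (X Y : {set n.-tuple bool}) : Prop :=
  [disjoint X & Y] /\ {in X & Y, forall x y, ~~ mh_adj x y}.

Lemma separatedC n (X Y : {set n.-tuple bool}) : separated X Y -> separated Y X.
Proof.
case=> dXY nXY; split; first by rewrite disjoint_sym.
by move=> y x yY xX; rewrite mh_adj_sym nXY.
Qed.

Lemma separated_half n b (X Y : {set n.+1.-tuple bool}) :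
  separated X Y -> separated (half b X) (half b Y).
Proof.
case=> dXY nXY; split=> [|x y].
  apply/pred0P=> x; rewrite /= !inE.
  by apply/negP=> /andP[xX]; rewrite (disjointFr dXY xX).
by rewrite !inE => xX yY; have := nXY _ _ xX yY; rewrite mh_adj_cons eqxx.
Qed.

Lemma separated_card n (X Y : {set n.-tuple bool}) :
  separated X Y -> #|X| + #|Y| <= 2 ^ n.
Proof.
case=> dXY _; have := card_tuple_set (X :|: Y).
by rewrite cardsU disjoint_setI0 // cards0 subn0.
Qed.

Lemma separated_bdry n (X Y : {set n.-tuple bool}) :
  separated X Y -> #|bd X| + (#|X| + #|Y|) <= 2 ^ n.
Proof.
case=> dXY nXY; have := card_tuple_set (bd X :|: (X :|: Y)).
rewrite [#|bd X :|: _|]cardsU [bd X :&: _](_ : _ = set0) ?cards0 ?subn0; last first.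
  apply/setP=> y; rewrite in_set0 in_setI in_setU; apply/negP=> /andP[].
  case/bdryP=> /negPf-> [x xX xy] /= yY.
  by have := nXY _ _ xX yY; rewrite xy.
by rewrite cardsU disjoint_setI0 // cards0 subn0.
Qed.

(** The mate of a vertex of X cannot be in Y. *)
Lemma separated_mate n b (X Y : {set n.+1.-tuple bool}) :
  separated X Y -> #|half b X| + #|half (~~ b) Y| <= 2 ^ n.
Proof.
case=> dXY nXY; rewrite -(card_imset _ (@mate_inj n)).
have := card_tuple_set (@mate n @: half b X :|: half (~~ b) Y).
rewrite cardsU [_ :&: _](_ : _ = set0) ?cards0 ?subn0 //.
apply/setP=> y; rewrite in_set0 in_setI; apply/negP=> /andP[/imsetP[x]].
rewrite !inE => xX -> yY; have := nXY _ _ xX yY; rewrite mh_adj_cons eqxx.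
by case: (b).
Qed.

(** The case k = 1 of [separated_bound], for all n: the graph is n-connected.  It is
treated apart because the range 1 <= k <= n - 2 is empty for n <= 2. *)
Lemma mh_connectivity n (X Y : {set n.-tuple bool}) :
  separated X Y -> X != set0 -> Y != set0 -> n + (#|X| + #|Y|) <= 2 ^ n.
Proof.
elim: n X Y => [|n IHn] X Y sXY; first by move=> _ _; apply: separated_card.
rewrite -!card_gt0 (half_card X) (half_card Y) => X_gt0 Y_gt0.
have IH b : 0 < #|half b X| -> 0 < #|half b Y| ->
    n + (#|half b X| + #|half b Y|) <= 2 ^ n.
  by rewrite !card_gt0; apply/IHn/separated_half.
have crd b := separated_card (separated_half b sXY).
have crs b := separated_mate b sXY.
rewrite expnS; have n20 : n = 0 -> 2 ^ n = 1 by move=> ->.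
apply: connectivity_arith => //.
- exact: ltn_expl.
- exact: IH.
- exact: IH.
Qed.

Lemma separated_expansion n (X Y : {set n.-tuple bool}) :
  separated X Y -> 0 < #|X| -> sep_bound n (2 ^ n) #|X| #|X| #|Y|.
Proof.
move=> sXY; rewrite card_gt0 => /bdry_expansion; have := separated_bdry sXY.
rewrite /sep_bound; move: (2 ^ n) => N; lia.
Qed.

(** The range of k cannot be extended for n >= 4: in the hypercube, where every mate is the
identity, a vertex and its neighbours form a set of n + 1 vertices with only
n (n - 1) / 2 outer neighbours, one less than the bound at k = n - 1. *)
Lemma separated_bound n k (X Y : {set n.-tuple bool}) :
  separated X Y -> 0 < k -> k + 2 <= n -> k <= #|X| -> k <= #|Y| ->
  sep_bound n (2 ^ n) k #|X| #|Y|.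
Proof.
elim: n k X Y => [|n IHn] k X Y sXY k_gt0 kn kX kY; first by lia.
have [k1 | k1] := leqP k 1.
  have := mh_connectivity sXY.
  rewrite -!card_gt0 (leq_trans k_gt0 kX) (leq_trans k_gt0 kY) => /(_ isT isT).
  by rewrite /sep_bound (_ : k = 1) //; lia.
have sh b : sep_half n (2 ^ n) #|half b X| #|half b Y|.
  have s_b := separated_half b sXY; split.
  - exact: separated_card.
  - exact: separated_expansion.
  - by move=> Y_gt0; apply/sep_boundC/separated_expansion/Y_gt0/separatedC.
  - by move=> p *; apply: IHn.
rewrite expnS (half_card X) (half_card Y); apply: sep_bound_step => //.
- by rewrite k1; lia.
- exact: (separated_mate false).
- exact: (separated_mate true).
- by rewrite -half_card.
- by rewrite -half_card.
Qed.

End MatchedHalves.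

(** * The varietal hypercube *)

(** The crossing rule 00-00, 01-01, 10-11, 11-10 on the first two letters. *)
Definition twist (s : seq bool) : seq bool :=
  if s is a :: b :: r then a :: (b (+) a) :: r else s.

Lemma vq_mate_subproof n (x : n.-tuple bool) :
  size (if 3 %| n.+1 then twist x else x) == n.
Proof. by case: ifP; rewrite ?size_tuple //; case: x => [[|a [|b r]]]. Qed.

Definition vq_mate n (x : n.-tuple bool) : n.-tuple bool :=
  Tuple (vq_mate_subproof x).

Lemma vq_mateK n : involutive (@vq_mate n).
Proof.
move=> x; apply: val_inj => /=; case: (3 %| n.+1) => //.
by case: x => [[|a [|b r]]] //= _; rewrite -addbA addbb addbF.
Qed.

Lemma vq_mate_inj n : injective (@vq_mate n).
Proof. exact: can_inj (@vq_mateK n). Qed.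

Lemma vq_mate_id n (x : n.-tuple bool) : ~~ (3 %| n.+1) -> vq_mate x = x.
Proof. by move=> n3; apply: val_inj; rewrite /= (negPf n3). Qed.

Lemma vq_cross_mate n (x y : n.-tuple bool) : vq_cross n.+1 x y = (y == vq_mate x).
Proof.
rewrite /vq_cross -val_eqE /=; case: ifP => n3; last exact: eq_sym.
case: x y => x xn [y yn] /=.
have := eqP xn; have := eqP yn; case: n n3 {xn yn} => [|[|n]] //= _.
case: y => [|c [|d y]] //; case: x => [|a [|b x]] //= _ _.
rewrite !drop0 !take0 !inE !xpair_eqE [x == y]eq_sym.
by case: a b c d => -[] [] []; rewrite /= ?andbF ?andbT.
Qed.

Lemma vq_adjE n : @vq_adj n =2 @mh_adj vq_mate n.
Proof.
elim: n => // n IHn x y; case/tupleP: x => a x; case/tupleP: y => b y.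
rewrite mh_adj_cons /= !theadE !behead_cons vq_cross_mate IHn.
have [n0 | _] := eqVneq n 0; last by [].
subst n; rewrite [y]tuple0 [x]tuple0 [vq_mate _]tuple0 -val_eqE /= eqseq_cons andbT.
by case: a b => -[].
Qed.

(** * Stars and their boundaries *)

Section Stars.

Notation nb := (nbhd (@mh_adj vq_mate _)).
Notation bd := (bdry (@mh_adj vq_mate _)).

Definition origin n : n.-tuple bool := nseq_tuple n false.

Lemma origin_cons n : origin n.+1 = [tuple of false :: origin n].
Proof. exact: val_inj. Qed.

Lemma vq_mate_origin n : vq_mate (origin n) = origin n.
Proof. by apply: val_inj => /=; case: ifP => //; case: n => [|[]]. Qed.

Definition ball n : {set n.-tuple bool} := origin n |: nb (origin n).

(** Taking mates fixes the strings that start with 0, and the only string of the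
ball that starts with 1 is the top neighbour of the origin. *)
Lemma card_mate_ball_out n : #|@vq_mate n @: ball n :\: ball n| <= 1.
Proof.
case: n => [|n]; first by rewrite (leq_trans (card_tuple_set _)).
rewrite -[X in _ <= X](cards1 (vq_mate [tuple of true :: origin n])).
apply/subset_leq_card/subsetP=> z /setDP[/imsetP[x xB ->{z}] xNB].
have xx : vq_mate x != x by apply: contraNneq xNB => ->.
rewrite inE (inj_eq (@vq_mate_inj _)); case/tupleP: x xB xx {xNB} => -[] x xB xx.
  move: xB; rewrite !inE origin_cons cons_tuple_eq mh_adj_cons vq_mate_origin.
  by move=> /= /eqP->.
case/eqP: xx; apply: val_inj => /=; case: ifP => //.
by case: (tval x) => //= b r _; rewrite addbF.
Qed.

(** The last clause is carried through the induction for the sake of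
[star_Rg_cutset]; with it, vertices off the star keep a large degree when the
boundary is deleted.  The fourth one says twice that the boundary has at most
f_n(g) vertices. *)
Definition star n g (X : {set n.-tuple bool}) : Prop :=
  [/\ origin n \in X, X \subset ball n, #|X| = g.+1,
      2 * #|bd X| + g * (g + 3) <= 2 * (n * (g + 1)) &
      forall y, y \notin X -> y \notin bd X -> #|nb y :&: bd X| <= 4].

Lemma star0 : star 0 [set origin 0].
Proof.
split; rewrite ?set11 ?cards1 ?subsetUl //.
  by rewrite bdry1 ?card_nbhd //; apply: mh_adj_irr.
by move=> y; rewrite [y]tuple0 [origin 0]tuple0 set11.
Qed.

Lemma half_ball n : half false (ball n.+1) = ball n.
Proof.
by apply/setP=> x; rewrite !inE origin_cons mh_adj_cons cons_tuple_eq.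
Qed.

Lemma card_nbhdI n b (y : n.-tuple bool) (A : {set n.+1.-tuple bool}) :
  #|nb [tuple of b :: y] :&: A| = #|nb y :&: half b A| + (vq_mate y \in half (~~ b) A).
Proof.
rewrite (half_cardb b) !halfI (half_nbhd _ b) (half_nbhdC _ b); congr addn.
exact: card_set1I.
Qed.

(** The new boundary is the old one together with the mates of the star.  A vertex
y of the new half meets these in at most 2 + 1 neighbours, as they lie in the
ball of the origin with one exception at most, and it has one more neighbour,
its mate, in the other half. *)
Lemma star_widen n g X : @star n g X -> star g (join_halves X set0).
Proof.
case=> oX Xball cX cbd deg.
have h0 : half false (bd (join_halves X set0)) = bd X.
  apply/setP=> y; rewrite (in_half_bdry vq_mateK) !half_join /= in_set0 orbF andb_idl //.
  by case/bdryP.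
have h1 : half true (bd (join_halves X set0)) = @vq_mate n @: X.
  apply/setP=> y; rewrite (in_half_bdry vq_mateK) !half_join /= in_set0 /=.
  by rewrite (can2_imset_pre _ (@vq_mateK n) (@vq_mateK n)) [RHS]inE bdry0 in_set0.
split.
- by rewrite origin_cons in_join_halves.
- apply: half_subset => -[]; rewrite half_join ?sub0set //.
  by rewrite half_ball.
- by rewrite half_card !half_join cards0 addn0.
- rewrite half_card h0 h1 card_imset; last exact: vq_mate_inj.
  by rewrite cX; move: #|bd X| cbd => c; nia.
move=> y'; case/tupleP: y' => -[] y; rewrite in_join_halves -!in_half card_nbhdI h0 h1 /=.
  move=> _ yX; rewrite -[4]/(2 + 1 + 1) leq_add ?leq_b1 //.
  have yo : y != origin n.
    by apply: contraNneq yX => ->; rewrite -vq_mate_origin imset_f.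
  apply: leq_trans (leq_add (card_nbhd_ball vq_mateK yo) (card_mate_ball_out n)).
  rewrite -cardsUI (leq_trans _ (leq_addr _ _)) // subset_leq_card //.
  apply/subsetP=> z; rewrite inE => /andP[yz zX].
  have zB : z \in @vq_mate n @: ball n by apply: subsetP zX; apply: imsetS.
  by rewrite -/(ball n) in_setU in_setI in_setD zB yz andbT orbN.
move=> yX ybd; rewrite mem_imset ?(negPf yX) ?addn0; last exact: vq_mate_inj.
exact: deg.
Qed.

(** The new leaf is the mate of the origin.  In its half the star has as outer
neighbours exactly the neighbours of the leaf, since these include the mates
of the old leaves. *)
Lemma star_add_leaf n g X : ~~ (3 %| n.+1) ->
  @star n g X -> star g.+1 (join_halves X [set origin n]).
Proof.
move=> n3 [oX Xball cX cbd deg].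
have h0 : half false (bd (join_halves X [set origin n])) = bd X.
  apply/setP=> y; rewrite (in_half_bdry vq_mateK) !half_join /= vq_mate_id // in_set1.
  have [-> | _] := eqVneq y (origin n); last by rewrite orbF andb_idl // => /bdryP[].
  by rewrite oX; apply/esym/bdryP; rewrite oX => -[].
have h1 : half true (bd (join_halves X [set origin n])) = nb (origin n).
  apply/setP=> y; rewrite (in_half_bdry vq_mateK) !half_join /= vq_mate_id // in_set1.
  rewrite bdry1; last exact: mh_adj_irr.
  have [-> | yo] := eqVneq y (origin n); first by rewrite inE mh_adj_irr.
  by rewrite orb_idr // => /(subsetP Xball); rewrite !inE (negPf yo).
split.
- by rewrite origin_cons in_join_halves.
- apply: half_subset => -[]; rewrite half_join ?half_ball // sub1set in_half.
  by rewrite !inE origin_cons cons_tuple_eq mh_adj_cons vq_mate_origin eqxx.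
- by rewrite half_card !half_join cards1 addn1 cX.
- rewrite half_card h0 h1 card_nbhd //; move: #|bd X| cbd => c; nia.
move=> y'; case/tupleP: y' => -[] y; rewrite in_join_halves -!in_half card_nbhdI h0 h1 /=.
  rewrite in_set1 => yo _.
  have := card_common_nbhd vq_mateK yo; case: (_ \in _) => /=; lia.
move=> yX ybd; rewrite vq_mate_id // (_ : y \in nb _ = false) ?addn0 ?deg //.
apply/negP; rewrite inE => oy; case/bdryP: ybd; split=> //; exists (origin n) => //; rewrite inE.
Qed.

(** There are n - n / 3 coordinates whose index is not a multiple of 3. *)
Lemma star_exists n g : g <= n - n %/ 3 -> exists X, @star n g X.
Proof.
elim: n g => [|n IHn] g gn.
  have -> : g = 0 by lia.
  by exists [set origin 0]; apply: star0.
have [g_small | g_big] := leqP g (n - n %/ 3).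
  by have [X /star_widen sX] := IHn g g_small; exists (join_halves X set0).
case: g gn g_big => [|g] gn g_big; first by lia.
have [X sX] := IHn g ltac:(lia).
by exists (join_halves X [set origin n]); apply: star_add_leaf => //; lia.
Qed.

Lemma star_Rg_cutset n g X : 8 < n -> g + 3 <= n -> @star n g X ->
  Rg_cutset (@mh_adj vq_mate n) g (bd X).
Proof.
move=> n8 gn [oX Xball cX cbd deg].
have [y yN] : exists y, y \notin X :|: bd X.
  apply/existsP; rewrite -negb_forall; apply/negP=> /forallP full.
  (* Otherwise 2^n <= g + 1 + f_n(g) < n^2. *)
  have : 2 ^ n <= #|X| + #|bd X|.
    rewrite -card_bool -card_tuple -cardsT -cardsUI (leq_trans _ (leq_addr _ _)) //.
    by apply/subset_leq_card/subsetP=> y _; apply: full.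
  have : n * n < 2 ^ n.
    elim: n n8 {X gn oX Xball cX cbd deg full} => // n IHn.
    rewrite ltnS leq_eqVlt => /predU1P[<- // | /[dup] n8 /IHn].
    by rewrite expnS; move: (2 ^ n) => N; nia.
  rewrite cX; move: (2 ^ n) #|bd X| cbd => N c; nia.
apply: (bdry_Rg_cutset (@mh_adj_sym _ vq_mateK n) oX Xball _ yN); first by rewrite cX.
move=> z zN; apply: (@leq_trans (2 * (n - 4))); first by lia.
have zS : z \notin bd X by move: zN; rewrite in_setU negb_or => /andP[].
apply: component_ge => //; first exact: mh_adj_triangle vq_mateK _.
  by lia.
move=> u uC; have : u \in ~: (X :|: bd X).
  apply: subsetP uC; apply: component_sub; first by rewrite inE.
  move=> v w; rewrite !in_setC !in_setU !negb_or => /andP[vX vS] wS vw; rewrite wS andbT.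
  apply: contra vS => wX; apply/bdryP; split=> //; exists w => //.
  by rewrite (mh_adj_sym vq_mateK).
rewrite in_setC in_setU negb_or => /andP[uX uS].
have := deg u uX uS; have := cardsID (bd X) (nb u); rewrite card_nbhd //; lia.
Qed.

End Stars.

(** * The extra connectivity *)

Lemma Rg_cutset_bound n g S : g + 3 <= n ->
  Rg_cutset (@mh_adj vq_mate n) g S -> 2 * (n * (g + 1)) <= 2 * #|S| + g * (g + 3).
Proof.
move=> gn /(Rg_cutset_parts (@mh_adj_sym _ vq_mateK n)) [X [Y [gX gY cXY dXY nXY]]].
have := separated_bound vq_mateK (conj dXY nXY) (ltn0Sn g) _ gX gY.
rewrite card_tuple card_bool in cXY; rewrite /sep_bound -cXY => /(_ ltac:(lia)).
by move: #|S| #|X| #|Y| => c a b; nia.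
Qed.

Theorem theorem4p7 (n s t g : nat) (hn : n = 3 * s + t) (hs : 3 <= s)
  (ht : t <= 2) (hg : g <= n - s) :
  extra_connectivity (@vq_adj n) g = Some (f_bound n g).
Proof.
have n8 : 8 < n by lia.
have gn : g + 3 <= n by lia.
have fE := f_bound_exact (leq_trans hg (leq_subr s n)).
have lower S : Rg_cutset (@vq_adj n) g S -> f_bound n g <= #|S|.
  rewrite (eq_Rg_cutset _ _ (@vq_adjE n)) => /(Rg_cutset_bound gn); lia.
have [X sX] : exists X, @star n g X by apply: star_exists; lia.
have cutX : Rg_cutset (@vq_adj n) g (bdry (@mh_adj vq_mate n) X).
  by rewrite (eq_Rg_cutset _ _ (@vq_adjE n)); apply: star_Rg_cutset.
apply/extra_connectivityP; split=> //; exists (bdry (@mh_adj vq_mate n) X) => //.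
apply/eqP; rewrite eqn_leq lower // andbT.
by case: sX => _ _ _ cbd _; lia.
Qed.
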